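(* Let $k\geq 2$ be any natural number. Then $n(k,3)=2k+1$.
   Context: $S_n$ and $A_n$ denote the symmetric and alternating groups on $n$ letters. For natural numbers $k,l\geq 2$ such that $l$ is odd or $k$ is even, $n(k,l)$ denotes the largest natural number $n$ such that every element of $A_n$ can be written as a product of $k$ (not necessarily distinct) $l$-cycles of $S_n$; equivalently, the largest $n$ such that $C_l^k=A_n$, where $C_l$ is the set of all $l$-cycles in $S_n$ and $C_l^k=\{x_1x_2\cdots x_k \mid x_i\in C_l\}$. *)

(* Defs.v *)
From mathcomp Require Import all_boot all_fingroup all_solvable.

Set Implicit Arguments.
Unset Strict Implicit.
Unset Printing Implicit Defensive.

Import GroupScope.

(* The permutations of the form (c_1 c_2 ... c_l) with c_1, ..., c_l pairwise *)
(* distinct: [next c] sends each c_i to c_(i+1), c_l to c_1, and fixes every  *)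
(* point that is not in c.                                                    *)
Definition lcycles (l n : nat) : {set 'S_n} :=
  [set s : 'S_n |
    [exists c : l.-tuple 'I_n, uniq c && [forall x, s x == next c x]]].

(* [^+] is the power for the elementwise product of subsets of 'S_n, so the   *)
(* left-hand side is the set of all products x_1 x_2 ... x_k of l-cycles.     *)
Definition lcycles_cover (k l n : nat) : Prop :=
  lcycles l n ^+ k = 'Alt_('I_n) :> {set 'S_n}.

(* N = n(k, l); stated as a relation because n(k, l) is the maximum of a set  *)
(* of natural numbers, which is not known a priori to exist.                  *)
Definition is_ncover (k l N : nat) : Prop :=
  lcycles_cover k l N /\ forall n : nat, lcycles_cover k l n -> (n <= N)%N.

(* Main.v *)
(* Lower bound: a nontrivial even s supported on at most 2m+3 points can be   *)
(* written c * t with c a 3-cycle and t supported on at most 2m+1 points: if  *)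
(* s is not an involution take c = (x, s x, s (s x)); otherwise the support   *)
(* of s has even size and c = (x, s x, z), for z any other moved point, frees *)
(* one point, which is enough. Hence s = 1 or s is a product of at most m+1   *)
(* 3-cycles, and 3-cycles can be added since c = c^-1 * c^-1.                 *)
(* Upper bound: a set containing x and stable under k given 3-cycles can be   *)
(* found with at most 2k+1 points, since adding the support of a 3-cycle that *)
(* does not preserve the current set adds at most 2 points. If n > 2k+1 is odd *)
(* this rules out the n-cycle. If n is even, take (0 1)(2 3 ... n-1): the set *)
(* built from 2 has to be the complement of {0, 1}, so every factor preserves *)
(* {0, 1}, hence fixes 0 and 1, whereas the product swaps them.               *)

Require Import Defs.
From mathcomp Require Import all_boot all_fingroup all_solvable.
From mathcomp Require Import zify.

Set Implicit Arguments.
Unset Strict Implicit.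
Unset Printing Implicit Defensive.

Import GroupScope.

(** Each 3-cycle accounts for two points, in both bounds. Below, [even_peel] splits a 3-cycle off a
    nontrivial even permutation and lowers the bound on its moved points by two; iterating gives
    [Alt_lcycles3_expg], with [lcycles3_expg] padding products that end early and
    [one_lcycles3_expg] treating the identity. Above, [stable_hull] encloses any point in a set of
    at most 2k+1 points preserved by every factor. So a product of k 3-cycles is not transitive on
    more than 2k+1 points, which excludes the n-cycle for odd n; for even n that cycle is odd, and
    (0 1)(2 ... n-1) is excluded because no 3-cycle swaps two points. *)

Section ThreeCycle.

(** * Splitting a 3-cycle off an even permutation *)

Variable T : finType.
Implicit Types (x y z w : T) (s t : {perm T}).

Definition cycle3 x y z : {perm T} := tperm x y * tperm x z.

Lemma uniq3C x y z : uniq [:: x; y; z] -> uniq [:: x; z; y].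
Proof. by rewrite !cons_uniq !inE (orbC (x == y)) (eq_sym y). Qed.

Lemma cycle3E x y z w : uniq [:: x; y; z] ->
  cycle3 x y z w =
    if w == x then y else if w == y then z else if w == z then x else w.
Proof.
rewrite /= !inE negb_or andbT => /andP[/andP[xy xz] yz].
rewrite permM; have [->|wx] := eqVneq w x.
  by rewrite tpermL tpermD // eq_sym.
have [->|wy] := eqVneq w y; first by rewrite tpermR tpermL.
rewrite [tperm x y w]tpermD 1?eq_sym //.
by have [->|wz] := eqVneq w z; rewrite ?tpermR // tpermD // eq_sym.
Qed.

Lemma cycle3V x y z : (cycle3 x y z)^-1 = cycle3 x z y.
Proof. by rewrite invMg !tpermV. Qed.

Lemma cycle3_sq x y z : uniq [:: x; y; z] ->
  cycle3 x y z * cycle3 x y z = cycle3 x z y.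
Proof.
move=> U; have U' := uniq3C U; apply/permP=> w; rewrite permM !cycle3E //.
move: U; rewrite /= !inE negb_or andbT => /andP[/andP[xy xz] yz].
have [_|wx] := eqVneq w x; first by rewrite eq_sym (negPf xy) eqxx.
have [->|wy] := eqVneq w y.
  by rewrite (negPf yz) eq_sym (negPf xz) eq_sym (negPf yz) eqxx.
by case: (eqVneq w z) => [_|wz];
  rewrite ?eqxx ?(negPf wx) ?(negPf wy) ?(negPf wz).
Qed.

Lemma odd_cycle3 x y z : uniq [:: x; y; z] -> cycle3 x y z = false :> bool.
Proof.
rewrite /= !inE negb_or andbT => /andP[/andP[xy xz] yz].
by rewrite odd_mul_tperm odd_tperm xy xz.
Qed.

Definition supp s : {set T} := [set x | s x != x].

Lemma supp_perm s x : (s x \in supp s) = (x \in supp s).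
Proof. by rewrite !inE inj_eq //; apply: perm_inj. Qed.

Lemma cycle3_supp x y z w : w \notin [:: x; y; z] -> cycle3 x y z w = w.
Proof.
rewrite !inE !negb_or => /and3P[wx wy wz].
by rewrite permM !tpermD // eq_sym.
Qed.

Lemma card_supp_cycle3 x y z : #|supp (cycle3 x y z)| <= 3.
Proof.
apply: leq_trans (card_size [:: x; y; z]); apply/subset_leq_card/subsetP=> w.
by rewrite inE; apply: contraR => /cycle3_supp ->.
Qed.

(** Wherever [c u = s u], the quotient [t] fixes that common image; outside [supp s] both factors
    are trivial. Each agreement thus frees one point. *)
Lemma supp_strip s x y z (c := cycle3 x y z) (t := c^-1 * s) :
    [&& x \in supp s, y \in supp s & z \in supp s] ->
  supp t \subset supp s :\: [set s u | u in [set u | c u == s u]].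
Proof.
move=> /and3P[xs ys zs]; apply/subsetP=> w; rewrite in_setD => tw.
apply/andP; split.
  apply: contraL tw => /imsetP[u]; rewrite !inE => /eqP cu ->.
  by rewrite negbK permM -cu permK cu.
apply: contraLR tw => ws; rewrite !inE negbK permM.
have -> : c^-1 w = w.
  rewrite cycle3V cycle3_supp // !inE.
  by apply: contra ws => /or3P[] /eqP->.
by move: ws; rewrite inE negbK.
Qed.

(** The 2-group generated by [s] acts on [supp s] without fixed points. *)
Lemma involution_supp_even s : s * s = 1 -> ~~ odd #|supp s|.
Proof.
move=> ss1.
have act : [acts <[s]>, on supp s | 'P].
  rewrite cycle_subG inE; apply/andP; split; rewrite inE //.
  by apply/subsetP=> x xs; rewrite inE /= apermE supp_perm.
have p2 : 2.-group <[s]>.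
  by apply: (@pnat_dvd _ 2) => //; rewrite order_dvdn expgS expg1 ss1.
have := pgroup_fix_mod p2 act.
rewrite !modn2 afix_cycle (_ : _ :&: _ = set0) ?cards0; first by case: odd.
apply/setP=> x; rewrite !inE sub1set inE /= apermE.
by case: eqP.
Qed.

Lemma even_peel s m : s != 1 -> ~~ odd_perm s -> #|supp s| <= m.*2.+3 ->
  exists x y z, uniq [:: x; y; z] /\
    #|supp ((cycle3 x y z)^-1 * s)| <= m.*2.+1.
Proof.
move=> s1 evs supps.
have [/existsP[x sxx]|] := boolP [exists x, s (s x) != x].
  have sx : x \in supp s.
    by rewrite inE; apply: contra sxx => /eqP sx; rewrite !sx.
  have U : uniq [:: x; s x; s (s x)].
    move: (sx) (sx); rewrite -{1}supp_perm !inE => ssx xsx.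
    by rewrite /= !inE negb_or (eq_sym x) xsx (eq_sym x) sxx (eq_sym (s x)) ssx.
  exists x, (s x), (s (s x)); split=> //.
  have sub := @supp_strip s x (s x) (s (s x)).
  rewrite !supp_perm sx in sub; move/(_ isT): sub => /subset_leq_card.
  move/leq_trans; apply.
  (* The cycle agrees with [s] at [x] and at [s x], so two points are freed. *)
  have sub2 : [set s x; s (s x)] \subset
      [set s u | u in [set u | cycle3 x (s x) (s (s x)) u == s u]].
    apply/subsetP=> w; rewrite !inE => /orP[]/eqP->; apply: imset_f;
      rewrite inE cycle3E // !eqxx //.
    by move: sx; rewrite inE => /negPf->.
  apply: leq_trans (subset_leq_card (setDS _ sub2)) _.
  rewrite cardsD (setIidPr _); last first.
    by apply/subsetP=> w; rewrite in_set2 => /orP[]/eqP->; rewrite !supp_perm.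
  have -> : #|[set s x; s (s x)]| = 2.
    by move: U; rewrite cards2 /= !inE => /and3P[_ -> _].
  by lia.
rewrite negb_exists => /forallP inv.
have {inv} ss x : s (s x) = x by apply/eqP; move: (inv x); rewrite negbK.
have [x sx] : exists x, x \in supp s.
  apply/set0Pn; apply: contraNneq s1 => s0; apply/eqP/permP=> x.
  by move/setP/(_ x): s0; rewrite !inE perm1 => /negbFE/eqP.
have xsx : s x != x by move: sx; rewrite inE.
have [z /andP[sz nz]] : exists z, (z \in supp s) && (z \notin [:: x; s x]).
  (* With no third moved point, [s] would be a transposition, hence odd. *)
  apply/existsP; apply: contraR evs; rewrite negb_exists => /forallP H.
  have -> : s = tperm x (s x).
    apply/permP=> w; have := H w; rewrite negb_and negbK => /orP[].
      rewrite inE negbK => /eqP sw; rewrite sw tpermD //.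
        by apply: contraNneq xsx => ->; rewrite sw.
      by apply: contraNneq xsx => ws; rewrite -{2}[x]ss ws sw.
    by rewrite !inE => /orP[]/eqP->; rewrite ?tpermL ?tpermR ?ss.
  by rewrite odd_tperm eq_sym.
have U : uniq [:: x; s x; z].
  move: nz; rewrite /= !inE !negb_or => /andP[zx zs].
  by rewrite eq_sym xsx eq_sym zx eq_sym zs.
exists x, (s x), z; split=> //.
have := @supp_strip s x (s x) z.
rewrite supp_perm sx sz => /(_ isT)/subset_leq_card/leq_trans; apply.
have sub1 : [set s x] \subset
    [set s u | u in [set u | cycle3 x (s x) z u == s u]].
  by rewrite sub1set imset_f // inE cycle3E // eqxx.
apply: leq_trans (subset_leq_card (setDS _ sub1)) _.
have := cardsD1 (s x) (supp s); rewrite supp_perm sx.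
(* Only [s x] is freed here, but parity already improves the bound 2m+3 to 2m+2. *)
have : ~~ odd #|supp s|.
  by apply: involution_supp_even; apply/permP=> w; rewrite permM ss perm1.
by lia.
Qed.

End ThreeCycle.

(** * Products of 3-cycles and the lower bound *)

Lemma lcycles3P n (s : 'S_n) :
  reflect (exists x y z, uniq [:: x; y; z] /\ s = cycle3 x y z)
          (s \in lcycles 3 n).
Proof.
have nextE (x y z : 'I_n) : uniq [:: x; y; z] ->
    next [:: x; y; z] =1 cycle3 x y z.
  by move=> U w; rewrite cycle3E //= ![_ == w]eq_sym.
rewrite inE; apply: (iffP existsP).
  move=> [[[|x[|y[|z[]]]]] //= i].
  by case/andP=> U /forallP E; exists x, y, z; split=> //;
    apply/permP=> w; rewrite -nextE //; apply/eqP/E.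
move=> [x [y [z [U ->]]]]; exists [tuple x; y; z]; rewrite U; apply/forallP=> w.
by rewrite -nextE.
Qed.

Lemma cycle3_in_lcycles n (x y z : 'I_n) :
  uniq [:: x; y; z] -> cycle3 x y z \in lcycles 3 n.
Proof. by move=> U; apply/lcycles3P; exists x, y, z. Qed.

Lemma lcycles3V n (s : 'S_n) : s \in lcycles 3 n -> s^-1 \in lcycles 3 n.
Proof.
move/lcycles3P=> [x [y [z [U ->]]]]; rewrite cycle3V.
exact: cycle3_in_lcycles (uniq3C U).
Qed.

Lemma lcycles3_sq n (s : 'S_n) : s \in lcycles 3 n -> s * s = s^-1.
Proof.
by move/lcycles3P=> [x [y [z [U ->]]]]; rewrite cycle3V cycle3_sq.
Qed.

(** The square of a 3-cycle is its inverse, so any factor can be replaced by two 3-cycles. *)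
Lemma lcycles3_expg n (s : 'S_n) j :
  s \in lcycles 3 n -> s \in lcycles 3 n ^+ j.+1.
Proof.
elim: j s => [|j IHj] s Cs; first by rewrite expg1.
have CV := lcycles3V Cs.
rewrite expgS -[s]invgK -(lcycles3_sq CV); apply: mem_mulg => //.
exact: IHj.
Qed.

Lemma one_lcycles3_expg n j : 2 < n -> 1 \in lcycles 3 n ^+ j.+2.
Proof.
move=> n2.
pose s := cycle3 (Ordinal (ltnW (ltnW n2))) (Ordinal (ltnW n2)) (Ordinal n2).
have Cs : s \in lcycles 3 n by apply: cycle3_in_lcycles.
rewrite expgS -[1](mulgV s) mem_mulg //.
by apply: lcycles3_expg; apply: lcycles3V.
Qed.

Lemma lcycles3_even n (s : 'S_n) : s \in lcycles 3 n -> s \in 'Alt_('I_n).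
Proof.
by move/lcycles3P=> [x [y [z [U ->]]]]; rewrite Alt_even odd_cycle3.
Qed.

Lemma lcycles3_expg_sub_Alt n k : lcycles 3 n ^+ k \subset 'Alt_('I_n).
Proof.
elim: k => [|k IHk]; first by rewrite expg0 sub1set group1.
rewrite expgS mul_subG //; apply/subsetP=> s; exact: lcycles3_even.
Qed.

(** The identity is kept apart because it is not a single 3-cycle, so the case [k = 1] would
    fail. *)
Lemma Alt_lcycles3_expg n k (s : 'S_n) : ~~ odd_perm s ->
  #|supp s| <= k.*2.+1 -> s = 1 \/ s \in lcycles 3 n ^+ k.
Proof.
elim: k s => [|k IHk] s evs supps; have [-> | s1] := eqVneq s 1; try by left.
  (* For [k = 0]: a moved point and its image are two distinct moved points, so a support of size at
     most 1 is empty. *)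
  right; case/negP: s1; apply/eqP/permP=> x; rewrite perm1; apply/eqP.
  rewrite -[_ == _]negbK; apply/negP=> sx.
  have := card_le1P supps x; rewrite inE sx => /(_ isT) /(_ (s x)).
  by rewrite supp_perm !inE sx (negPf sx).
right; have [x [y [z [U /IHk]]]] := even_peel s1 evs supps.
have Cc := cycle3_in_lcycles U.
case=> [||ct].
- by rewrite odd_permM odd_permV odd_cycle3.
- move=> /(canRL (mulKVg _)); rewrite mulg1 => ->; exact: lcycles3_expg.
- by rewrite expgS -[s](mulKVg (cycle3 x y z)) mem_mulg.
Qed.

Lemma lcycles3_cover k : 2 <= k -> lcycles_cover k 3 (2 * k + 1).
Proof.
move=> k2; apply/eqP; rewrite eqEsubset lcycles3_expg_sub_Alt /=.
apply/subsetP=> s; rewrite Alt_even => /(@Alt_lcycles3_expg _ k) [||//].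
  by apply: leq_trans (max_card _) _; rewrite card_ord; lia.
move->; case: k k2 s => [|[|k]] // _ _; apply: one_lcycles3_expg; lia.
Qed.

(** * Small sets preserved by every factor *)

Section Closure.

Variable T : finType.
Implicit Types (S : {set T}) (s : {perm T}) (l : seq {perm T}).

Definition stable S s := forall x, x \in S -> s x \in S.

Lemma stableC S s : stable S s -> stable (~: S) s.
Proof.
move=> Ss x; rewrite !inE; apply: contra => sxS.
have sub : s @: S \subset S by apply/subsetP=> _ /imsetP[y /Ss Sy ->].
have /eqP imS : s @: S == S.
  by rewrite eqEcard sub card_imset //=; apply: perm_inj.
by move: sxS; rewrite -{1}imS (mem_imset _ _ (@perm_inj _ s)).
Qed.

Lemma stable_prod S l :
  (forall s, s \in l -> stable S s) -> stable S (\prod_(s <- l) s).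
Proof.
elim: l => [|s l IHl] Sl x xS; first by rewrite big_nil perm1.
rewrite big_cons permM; apply: IHl => [t tl|].
  by apply: Sl; rewrite inE tl orbT.
by apply: Sl; rewrite ?mem_head.
Qed.

(** Whenever some factor fails to preserve the current set, its support is adjoined and the factor
    is dropped: it preserves every set containing its support. *)
Lemma stable_hull S l : (forall s, s \in l -> #|supp s| <= 3) ->
  exists2 S' : {set T}, S \subset S' /\ #|S'| <= #|S| + (size l).*2 &
    forall s, s \in l -> stable S' s.
Proof.
have [m] := ubnP (size l).
elim: m => // m IHm in S l * => lm l3.
have [/allP Sl|/allPn[s sl]] :=
    boolP (all (fun s => [forall (x | x \in S), s x \in S]) l).
  exists S; first by rewrite subxx leq_addr.
  by move=> s /Sl /forall_inP.
rewrite negb_forall_in => /exists_inP[x xS sxS].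
have szl := size_rem sl; have l_gt0 : 0 < size l by case: l sl {lm l3 szl}.
have [|t /mem_rem/l3 //|S' [SS' cS'] S'l] := IHm (S :|: supp s) (rem s l).
  by rewrite szl prednK.
have xs : x \in supp s by rewrite inE; apply: contraNneq sxS => ->.
exists S' => [|t tl].
  split; first exact: subset_trans (subsetUl _ _) SS'.
  apply: leq_trans cS' _; rewrite szl -[in leqRHS](prednK l_gt0).
  have := cardsUI S (supp s); have := l3 s sl.
  (* The support meets [S] at [x], so at most two of its three points are new. *)
  have : 0 < #|S :&: supp s| by apply/card_gt0P; exists x; rewrite inE xS.
  by move: (_.-1) => p; lia.
have [->|ts] := eqVneq t s; last first.
  by apply: S'l; move: tl; rewrite (perm_mem (perm_to_rem sl)) inE (negPf ts).
move=> y yS'; have [ys|] := boolP (y \in supp s).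
  by apply: (subsetP SS'); rewrite inE supp_perm ys orbT.
by rewrite inE negbK => /eqP->.
Qed.

End Closure.

Lemma expg_set_prod (gT : finGroupType) (A : {set gT}) k (s : gT) :
  s \in A ^+ k ->
  exists2 l : seq gT, size l = k /\ {subset l <= A} & s = \prod_(t <- l) t.
Proof.
elim: k s => [|k IHk] s; first by move/set1P->; exists [::]; rewrite ?big_nil.
rewrite expgS => /mulsgP[a t aA /IHk[l [<- lA] ->] ->].
exists (a :: l); last by rewrite big_cons.
by split=> // u; rewrite inE => /predU1P[->|/lA].
Qed.

Lemma lcycles3_expg_hull n k (s : 'S_n) (x : 'I_n) : s \in lcycles 3 n ^+ k ->
  exists (S : {set 'I_n}) (l : seq 'S_n),
    [/\ x \in S, #|S| <= k.*2.+1, {subset l <= lcycles 3 n},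
        s = \prod_(t <- l) t & forall t, t \in l -> stable S t].
Proof.
case/expg_set_prod=> l [<- lC] ->.
have [|S [xS cS] Sl] := @stable_hull _ [set x] l.
  by move=> t /lC/lcycles3P[a [b [c [_ ->]]]]; apply: card_supp_cycle3.
by exists S, l; rewrite sub1set in xS; rewrite cards1 in cS; split.
Qed.

(** * Even permutations that need more than k factors *)

Definition rotS n : 'S_n := perm (@ordS_inj n).

Lemma rotS_val n (i : 'I_n) : rotS n i = (i.+1 %% n)%N :> nat.
Proof. by rewrite permE. Qed.

Lemma stable_ge n (S : {set 'I_n}) (s : 'S_n) (i : 'I_n) : stable S s ->
    i \in S ->
    (forall j : 'I_n, i <= j -> j.+1 < n -> s j = j.+1 :> nat) ->
  forall j : 'I_n, i <= j -> j \in S.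
Proof.
move=> Ss iS sE [j jn] /=; elim: j jn => [|j IHj] jn ij.
  by rewrite (_ : Ordinal jn = i) //; apply: val_inj; move: ij => /=; lia.
have [ij'|ij'] := leqP i j; last first.
  by rewrite (_ : Ordinal jn = i) //; apply: val_inj => /=; lia.
have jn' := ltnW jn; rewrite (_ : Ordinal jn = s (Ordinal jn')).
  exact/Ss/IHj.
by apply: val_inj; rewrite /= sE.
Qed.

(** There is a single orbit, and the parity of a permutation is that of [n] plus the number of
    orbits. *)
Lemma odd_rotS n : 0 < n -> rotS n = ~~ odd n :> bool.
Proof.
case: n => // n _; rewrite /odd_perm card_ord.
suff -> : porbits (rotS n.+1) = [set setT] by rewrite cards1 addbT.
have orb0 : porbit (rotS n.+1) ord0 = setT.
  apply/setP=> j; rewrite inE.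
  apply: (@stable_ge _ _ (rotS n.+1) ord0) => //.
  - by move=> x; rewrite -!eq_porbit_mem (porbit_perm _ 1).
  - exact: porbit_id.
  - by move=> i _ ij; rewrite rotS_val modn_small.
apply/setP=> X; rewrite inE; apply/imsetP/eqP=> [[x _ ->]|->].
  by apply/eqP; rewrite -orb0 eq_porbit_mem orb0.
by exists ord0; rewrite ?orb0.
Qed.

Lemma rotS_not_lcycles3_expg n k :
  k.*2.+1 < n -> rotS n \notin lcycles 3 n ^+ k.
Proof.
move=> kn; pose i0 := Ordinal (ltn_trans (ltn0Sn _) kn).
apply/negP=> /(@lcycles3_expg_hull _ _ _ i0).
case=> S [l [xS cS _ rE Sl]].
have ST : S = setT.
  apply/setP=> j; rewrite inE; apply: (@stable_ge _ _ (rotS n) _ _ xS) => //.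
    by rewrite rE; apply: stable_prod Sl.
  by move=> i _ ij; rewrite rotS_val modn_small.
by move: cS; rewrite ST cardsT card_ord; lia.
Qed.

(* The permutation is (0 1)(2 3 ... n-1). *)
Lemma rotS_tperm_not_lcycles3_expg n k (i0 i1 i2 : 'I_n) :
    i0 = 0 :> nat -> i1 = 1%N :> nat -> i2 = 2 :> nat -> k.*2.+1 < n ->
  rotS n * tperm i0 i2 \notin lcycles 3 n ^+ k.
Proof.
move=> i0E i1E i2E kn; apply/negP=> /(@lcycles3_expg_hull _ _ _ i2).
set s := rotS n * _ => -[S [l [i2S cS lC sE Sl]]].
have n2 : 2 < n by rewrite -i2E.
have s0 : s i0 = i1.
  rewrite permM (_ : rotS n i0 = i1); last first.
    by apply: val_inj; rewrite /= rotS_val i0E i1E modn_small // ltnW.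
  by rewrite tpermD // -val_eqE /= ?i0E ?i1E ?i2E.
have s1 : s i1 = i0.
  rewrite permM (_ : rotS n i1 = i2) ?tpermR //.
  by apply: val_inj; rewrite /= rotS_val i1E i2E modn_small.
have Ss : stable S s by rewrite sE; apply: stable_prod.
have S_ge2 (j : 'I_n) : 2 <= j -> j \in S.
  rewrite -i2E; apply: (stable_ge Ss i2S) => i ij jn.
  have rE : rotS n i = i.+1 :> nat by rewrite rotS_val modn_small.
  by rewrite permM tpermD // -val_eqE /= rE ?i0E // neq_ltn ltnS ij.
have i0S : i0 \notin S.
  (* If 0 were in [S], then so would be 1, and [S] would have all [n] points, more than 2k+1. *)
  apply/negP=> i0S; have i1S : i1 \in S by rewrite -s0 Ss.
  suff ST : S = setT by move: cS; rewrite ST cardsT card_ord; lia.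
  apply/setP=> j; rewrite inE; have [/S_ge2 //|j2] := leqP 2 j.
  have [j0|j0] := eqVneq (val j) 0.
    by rewrite (_ : j = i0) //; apply: val_inj; rewrite j0 /= i0E.
  rewrite (_ : j = i1) //; apply: val_inj; rewrite /= i1E.
  by move: j0 j2 => /=; lia.
have i1S : i1 \notin S by apply: contra i0S => /Ss; rewrite s1.
have SC (j : 'I_n) : j \in ~: S -> j = i0 \/ j = i1.
  rewrite inE; have [/S_ge2->//|j2 _] := leqP 2 j.
  have [j0|j0] := eqVneq (val j) 0; [left|right]; apply: val_inj => /=.
    by rewrite i0E.
  by rewrite i1E; move: j0 j2 => /=; lia.
have i01 : i0 != i1 by rewrite -val_eqE /= i0E i1E.
(* Each factor preserves the complement of [S], which is {0, 1}. If [t] swapped these points,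
   [t * t], which is the inverse of [t], would fix 0, and so would [t]. *)
have fix0 (t : 'S_n) : t \in l -> stable [set i0] t.
  move=> tl _ /set1P->; apply/set1P.
  have St := stableC (Sl t tl).
  have [//|t0] : t i0 = i0 \/ t i0 = i1 by apply/SC/St; rewrite inE.
  have [t1|t1] : t i1 = i0 \/ t i1 = i1 by apply/SC/St; rewrite inE.
    have /permP/(_ i0) := lcycles3_sq (lC t tl); rewrite permM t0 t1.
    by move=> /(congr1 t); rewrite permKV t0.
  by case/eqP: i01; apply: (@perm_inj _ t); rewrite t0 t1.
have /set1P : s i0 \in [set i0].
  by rewrite sE; apply: (stable_prod fix0); rewrite inE.
by rewrite s0; apply/eqP; rewrite eq_sym.
Qed.

Theorem theoremA (k : nat) (hk : (2 <= k)%N) : is_ncover k 3 (2 * k + 1)%N.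
Proof.
split=> [|n cover]; first exact: lcycles3_cover.
rewrite leqNgt; apply/negP=> kn; have {}kn : k.*2.+1 < n by lia.
have n2 : 2 < n by lia.
(* The witness must lie in the alternating group: the n-cycle does for odd [n], and for even [n]
   multiplying it by a transposition corrects the sign. *)
have [odd_n|even_n] := boolP (odd n).
  have /negP[] := rotS_not_lcycles3_expg kn.
  by rewrite cover Alt_even odd_rotS ?odd_n //; lia.
have /negP[] := @rotS_tperm_not_lcycles3_expg n k
  (Ordinal (ltnW (ltnW n2))) (Ordinal (ltnW n2)) (Ordinal n2)
  erefl erefl erefl kn.
by rewrite cover Alt_even odd_permM odd_rotS ?odd_tperm ?even_n //; lia.
Qed.
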